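(* Let $q\in\{1,\ldots,5\}$ and let $\{(\mathbf{u}_h^n,p_h^n)\}_{n=q}^N\subset V_h\times Q_h$ be the solution of the fully discrete BDF-$q$ problem: for $n\ge q$, $$(\bar\partial_q\mathbf{u}_h^n,\mathbf{v}_h)+a(\mathbf{u}_h^n,\mathbf{v}_h)+b(p_h^n,\mathbf{v}_h)=(\mathbf{f}^n,\mathbf{v}_h)\quad\forall \mathbf{v}_h\in V_h,\qquad b(q_h,\mathbf{u}_h^n)-j_h(q_h,p_h^n)=0\quad\forall q_h\in Q_h,$$ with initial values $\mathbf{u}_h^i\in V_h$, $i=0,\ldots,q-1$. Suppose that the initial values are discretely divergence-free in the sense that for each $\mathbf{u}_h^i$, $i=0,\ldots,q-1$, there exists a corresponding $p_h^i\in Q_h$ such that $$b(q_h,\mathbf{u}_h^i)-j_h(p_h^i,q_h)=0\qquad\forall q_h\in Q_h .$$ Then for $0\le N\tau\le T$, $$\|\bar\partial_q\mathbf{u}_h^\tau\|_{\ell^2(J_q;H)}^2+\|\mathbf{u}_h^N\|_V^2+|p_h^N|_{j_h}^2\le C\Bigl[\sum_{i=0}^{q-1}\bigl(\|\mathbf{u}_h^i\|_V^2+|p_h^i|_{j_h}^2\bigr)+\|\mathbf{f}\|_{\ell^2(J_q;H)}^2\Bigr],$$ with a constant $C>0$ independent of $h$, $N$, $\tau$ and the final time $T$.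
   Context: Continuous setting. $\Omega\subset\mathbb{R}^d$, $d\in\{2,3\}$, is a Lipschitz domain, $J=(0,T)$, $\nu>0$ a constant. $H=[L^2(\Omega)]^d$, $V=[H_0^1(\Omega)]^d$, $Q=L_0^2(\Omega)$ (mean-zero $L^2$ functions), $(\cdot,\cdot)$ is the $L^2$ inner product, $a(\mathbf{u},\mathbf{v})=(\nu\nabla\mathbf{u},\nabla\mathbf{v})$, $b(p,\mathbf{v})=-(p,\nabla\cdot\mathbf{v})$, $\|\mathbf{v}\|_H=(\mathbf{v},\mathbf{v})^{1/2}$, $\|\mathbf{v}\|_V=a(\mathbf{v},\mathbf{v})^{1/2}$, $\|q\|_Q=\|\nu^{-1/2}q\|_{L^2}$. $c_P$ is the Poincaré constant: $\|\mathbf{v}\|_H\le c_P\nu^{-1/2}\|\mathbf{v}\|_V$ for $\mathbf{v}\in V$. $\|\cdot\|_m$ is the $H^m(\Omega)$ norm. Spatial discretization. $\{\mathcal{T}_h\}_{0<h\le1}$ is a quasi-uniform family of triangulations of $\Omega$ with mesh size $h$. With $k\ge1$, $l\ge0$, $k-1\le l\le k$, $V_h=[X_h]^d\cap V$ where $X_h$ is the space of continuous functions that are piecewise polynomial of degree $k$ on $\mathcal{T}_h$; $M_h\subset L^2(\Omega)$ is the space of (possibly discontinuous) piecewise polynomials of degree $l$; and $Q_h=M_h\cap Q$ or $Q_h=M_h\cap Q\cap C^0(\overline\Omega)$. The pressure stabilization $j_h:Q_h\times Q_h\to\mathbb{R}$ is bilinear, symmetric, positive semi-definite, with induced semi-norm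 $|q_h|_{j_h}=j_h(q_h,q_h)^{1/2}$, and $|j_h(p_h,q_h)|\le|p_h|_{j_h}|q_h|_{j_h}\le C\|p_h\|_Q\|q_h\|_Q$ ($j_h=0$ is allowed for inf-sup stable pairs). It is assumed that there are quasi-interpolation operators $\mathcal{I}_h^p:Q\to Q_h$, $\mathcal{I}_h^{\mathbf{u}}:V\to V_h$ with, for $s_p=\min\{s,\bar l,l+1\}$ ($\bar l\ge1$ the order of weak consistency of $j_h$) and $r_{\mathbf{u}}=\min\{r,k+1\}$: - $|\mathcal{I}_h^pq|_{j_h}\le C\nu^{-1/2}h^{s_p}\|q\|_{s_p}$ for $q\in Q\cap H^s(\Omega)$, and $\|q-\mathcal{I}_h^pq\|_Q\le C\nu^{-1/2}h^{l+1}\|q\|_{l+1}$ for $q\in Q\cap H^{l+1}(\Omega)$; - $\|\mathbf{v}-\mathcal{I}_h^{\mathbf{u}}\mathbf{v}\|_H+h\nu^{-1/2}\|\mathbf{v}-\mathcal{I}_h^{\mathbf{u}}\mathbf{v}\|_V\le C h^{r_{\mathbf{u}}}\|\mathbf{v}\|_{r_{\mathbf{u}}}$ for $\mathbf{v}\in V\cap[H^r(\Omega)]^d$; - $|b(q_h,\mathbf{v}-\mathcal{I}_h^{\mathbf{u}}\mathbf{v})|\le C|q_h|_{j_h}\bigl(\nu^{1/2}\|h^{-1}(\mathbf{v}-\mathcal{I}_h^{\mathbf{u}}\mathbf{v})\|_H+\|\mathbf{v}-\mathcal{I}_h^{\mathbf{u}}\mathbf{v}\|_V\bigr)$ for $(q_h,\mathbf{v})\in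 Q_h\times V$. These constants are independent of $h$. The assumptions imply (known result) the modified inf-sup condition $\beta\|q_h\|_Q\le\sup_{\mathbf{v}_h\in V_h}\frac{|b(q_h,\mathbf{v}_h)|}{\|\mathbf{v}_h\|_V}+C|q_h|_{j_h}$ for all $q_h\in Q_h$, with $\beta,C>0$ independent of $h$ and $\nu$. Time discretization. $t_n=n\tau$, $n=0,\ldots,N$, $\tau=T/N$. The BDF-$q$ discrete derivative is $\bar\partial_q\mathbf{w}^n=\frac1\tau\sum_{i=0}^q\delta_i\mathbf{w}^{n-i}$ for $n\ge q$, with $\delta_i$ defined by $\sum_{i=0}^q\delta_i\zeta^i=\sum_{m=1}^q\frac1m(1-\zeta)^m$. $\mathbf{f}\in C^0([0,T];[L^2(\Omega)]^d)$ and $\mathbf{f}^n=\mathbf{f}(t_n)$. $J_q=(t_q,T)$, and for a sequence $w^\tau=(w^n)_{n=q}^N$, $\|w^\tau\|_{\ell^2(J_q;\mathcal{H})}^2=\tau\sum_{n=q}^N\|w^n\|_{\mathcal{H}}^2$; $\|\mathbf{f}\|_{\ell^2(J_q;H)}$ uses the values $\mathbf{f}^n$. *)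

(* Defs.v *)
From HB Require Import structures.
From mathcomp Require Import all_boot all_order all_algebra.
From mathcomp Require Import all_classical all_reals all_analysis.
Set Implicit Arguments. Unset Strict Implicit. Unset Printing Implicit Defensive.
Import Order.TTheory GRing.Theory Num.Theory.
Import numFieldNormedType.Exports.
Local Open Scope classical_set_scope.
Local Open Scope ring_scope.

Section rV_measurable.
Variables (R : realType) (n : nat).

(* The product sigma-algebra, generated by the coordinates. *)
Let coord (i : 'I_n) (x : 'rV[R]_n) : measurableTypeR R := x 0 i.

Let rV_set0 : g_sigma_preimage coord set0.
Proof. exact: sigma_algebra0. Qed.

Let rV_setC A : g_sigma_preimage coord A -> g_sigma_preimage coord (~` A).
Proof. exact: sigma_algebraC. Qed.

Let rV_bigcup (F : (set 'rV[R]_n)^nat) :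
  (forall i, g_sigma_preimage coord (F i)) ->
  g_sigma_preimage coord (\bigcup_i F i).
Proof. exact: sigma_algebra_bigcup. Qed.

Fact rV_display : measure_display. Proof. exact: default_measure_display. Qed.

HB.instance Definition _ := @isMeasurable.Build rV_display
  'rV[R]_n (g_sigma_preimage coord) rV_set0 rV_setC rV_bigcup.

Lemma measurable_coord (i : 'I_n) :
  measurable_fun [set: 'rV[R]_n] (fun x => x 0 i : measurableTypeR R).
Proof.
move=> _ Y mY; rewrite setTI; apply: sub_sigma_algebra => /=.
rewrite -bigcup_seq/=; exists i => /=; first by rewrite mem_index_enum.
by exists Y => //; rewrite setTI.
Qed.

Lemma measurable_fun_rV d (T : measurableType d) (f : T -> 'rV[R]_n) :
  (forall i, measurable_fun [set: T] (fun x => f x 0 i : measurableTypeR R)) ->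
  measurable_fun [set: T] f.
Proof.
move=> mf _ Y mY; rewrite setTI.
suff sub : g_sigma_preimage coord `<=` image_set_system setT f measurable.
  by have := sub Y mY; rewrite /image_set_system /= setTI.
apply: smallest_sub.
  by apply: sigma_algebra_image; exact: sigma_algebra_measurable.
rewrite -bigcup_seq => A [i _ [B mB <-]]; rewrite /image_set_system /= !setTI.
by rewrite -[X in measurable X]setTI; exact: (mf i).
Qed.

End rV_measurable.

Section lebesgue_step.
Variables (R : realType) (n : nat).
Variable m : {sigma_finite_measure set 'rV[R]_n -> \bar R}.

Definition rV_cons (z : measurableTypeR R * 'rV[R]_n) : 'rV[R]_n.+1 :=
  row_mx (z.1%:M : 'rV_1) z.2.

(* The image of the product of the Lebesgue measure on [R] and of [m]. *)
Definition lebesgue_cons (A : set 'rV[R]_n.+1) : \bar R :=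
  (lebesgue_measure \x m)%E (rV_cons @^-1` A).

Lemma rV_consEl z : rV_cons z 0 0 = z.1.
Proof.
have -> : (0 : 'I_n.+1) = lshift n (0 : 'I_1) by apply/val_inj.
by rewrite /rV_cons (@row_mxEl _ 1 1 n) mxE eqxx mulr1n.
Qed.

Lemma rV_consEr z j : rV_cons z 0 (rshift 1 j) = z.2 0 j.
Proof. by rewrite /rV_cons (@row_mxEr _ 1 1 n). Qed.

Lemma measurable_rV_cons : measurable_fun setT rV_cons.
Proof.
apply: measurable_fun_rV => i.
have [->|[j ->]] : i = 0 \/ exists j : 'I_n, i = rshift 1 j.
- rewrite -[i](@splitK 1 n); case: (fintype.split (i : 'I_(1 + n))) => j /=.
    by left; apply/val_inj; rewrite /= ord1.
  by right; exists j.
- by under eq_fun do rewrite rV_consEl; exact: measurable_fst.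
- under eq_fun do rewrite rV_consEr.
  by apply: (measurableT_comp (measurable_coord j)); exact: measurable_snd.
Qed.

Let lebesgue_cons0 : lebesgue_cons set0 = 0%E.
Proof. by rewrite /lebesgue_cons preimage_set0 measure0. Qed.

Let lebesgue_cons_ge0 A : (0 <= lebesgue_cons A)%E.
Proof. exact: measure_ge0. Qed.

Let lebesgue_cons_sigma_additive : semi_sigma_additive lebesgue_cons.
Proof.
move=> F mF tF mUF; rewrite /lebesgue_cons preimage_bigcup.
apply: measure_semi_sigma_additive.
- by move=> k; rewrite -[X in measurable X]setTI; exact: measurable_rV_cons.
- apply/trivIsetP => /= i j _ _ ij; rewrite -preimage_setI.
  by move/trivIsetP : tF => /(_ _ _ _ _ ij) ->//; rewrite preimage_set0.
- by rewrite -preimage_bigcup -[X in measurable X]setTI; exact: measurable_rV_cons.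
Qed.

HB.instance Definition _ := isMeasure.Build _ _ _ lebesgue_cons
  lebesgue_cons0 lebesgue_cons_ge0 lebesgue_cons_sigma_additive.

Let lebesgue_cons_sigma_finite : sigma_finite setT lebesgue_cons.
Proof.
have [F FT mF] : sigma_finite setT (@lebesgue_measure R \x m)%E.
  have /sigma_finiteP[F [TF ndF Foo]] := sigma_finiteT (@lebesgue_measure R).
  have /sigma_finiteP[G [TG ndG Goo]] := sigma_finiteT m.
  exists (fun k => F k `*` G k).
    rewrite -setXTT TF TG predeqE => -[x y]; split.
      move=> [/= [i _ Fix] [j _ Gjy]]; exists (maxn i j) => //; split.
      - by move: x Fix; exact/subsetPset/ndF/leq_maxl.
      - by move: y Gjy; exact/subsetPset/ndG/leq_maxr.
    by move=> [i _ []/= ? ?]; split; exists i.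
  move=> k; have [? ?] := Foo k; have [? ?] := Goo k.
  split; first exact: measurableX.
  by rewrite product_measure1E// lte_mul_pinfty// ge0_fin_numE.
pose uncons (x : 'rV[R]_n.+1) : measurableTypeR R * 'rV[R]_n := (x 0 0, rsubmx (x : 'rV_(1 + n))).
have consK : cancel rV_cons uncons.
  by move=> [a v]; rewrite /uncons rV_consEl /rV_cons /= row_mxKr.
have mu : measurable_fun setT uncons.
  apply/measurable_fun_pairP; split => /=; first exact: measurable_coord.
  apply: measurable_fun_rV => i.
  by under eq_fun do rewrite /= mxE; exact: measurable_coord.
exists (fun k => uncons @^-1` F k).
  by rewrite -preimage_bigcup -FT preimage_setT.
move=> k; have [mFk Fk] := mF k; split.
  by rewrite -[X in measurable X]setTI; exact: mu.
rewrite /lebesgue_cons -comp_preimage.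
by rewrite (_ : uncons \o rV_cons = id) //; apply/funext => z; exact: consK.
Qed.

HB.instance Definition _ := Measure_isSigmaFinite.Build _ _ _ lebesgue_cons
  lebesgue_cons_sigma_finite.

End lebesgue_step.

(* Lebesgue measure on the Borel sets of [R^d]. *)
Fixpoint lebesgue_rV (R : realType) (d : nat) :
  {sigma_finite_measure set 'rV[R]_d -> \bar R} :=
  if d is n.+1 return {sigma_finite_measure set 'rV[R]_d -> \bar R}
  then lebesgue_cons (lebesgue_rV R n) else \d_(0 : 'rV[R]_0).

Section Geometry.
Variables (R : realType) (d : nat).
Implicit Types (x y e : 'rV[R]_d) (Omega : set 'rV[R]_d).

Definition dotr x y : R := \sum_i x 0 i * y 0 i.

(* The Euclidean norm; the library norm on ['rV[R]_d] is the sup norm. *)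
Definition enorm x : R := Num.sqrt (dotr x x).

(* Near each boundary point, [Omega] is the part of space strictly above the
   graph, over the hyperplane orthogonal to the unit vector [e], of a Lipschitz
   function [gamma].  Only the values of [gamma] on that hyperplane are used. *)
Definition lipschitz_domain Omega : Prop :=
  [/\ open Omega, connected Omega, Omega !=set0, bounded_set Omega &
    forall x, closure Omega x -> ~ Omega x ->
    exists (e : 'rV[R]_d) (gamma : 'rV[R]_d -> R) (L r : R),
      [/\ enorm e = 1, 0 < r,
          forall y z, `|gamma y - gamma z| <= L * enorm (y - z) &
          forall y, enorm (y - x) < r ->
            (Omega y <-> gamma (y - dotr y e *: e) < dotr y e)]].

(* A simplex is given by the matrix whose rows are its [d + 1] vertices.
   [face K S] is the convex hull of the vertices with index in [S]. *)
Definition face (K : 'M[R]_(d.+1, d)) (S : {set 'I_d.+1}) : set 'rV[R]_d :=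
  [set x | exists w : 'rV[R]_d.+1,
    [/\ forall i, 0 <= w 0 i, \sum_i w 0 i = 1,
        forall i, i \notin S -> w 0 i = 0 & x = w *m K]].

Definition simplex (K : 'M[R]_(d.+1, d)) : set 'rV[R]_d := face K [set: 'I_d.+1].

Definition nondegenerate (K : 'M[R]_(d.+1, d)) : bool :=
  \matrix_(i < d, j < d) (K (lift ord0 i) j - K ord0 j) \in unitmx.

(* Conformity: two simplices meet exactly in the face spanned by their common
   vertices (possibly the empty one). *)
Definition triangulation Omega (T : seq 'M[R]_(d.+1, d)) : Prop :=
  [/\ all nondegenerate T,
      closure Omega = [set x | exists2 K, K \in T & simplex K x] &
      forall K K', K \in T -> K' \in T ->
        simplex K `&` simplex K' =
        face K [set i | [exists i', row i K == row i' K']]].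

(* The mesh size [h] controls the diameters from above and, up to the factor
   [kappa], the inradii from below, uniformly over the mesh and over [h]. *)
Definition quasi_uniform Omega (Th : R -> seq 'M[R]_(d.+1, d)) : Prop :=
  (forall h, 0 < h <= 1 -> triangulation Omega (Th h)) /\
  exists2 kappa : R, 0 < kappa &
    forall h K, 0 < h <= 1 -> K \in Th h ->
      (forall x y, simplex K x -> simplex K y -> enorm (x - y) <= h) /\
      exists z, forall y, enorm (y - z) <= kappa * h -> simplex K y.

End Geometry.

Section Sobolev.
Variables (R : realType) (d : nat) (Omega : set 'rV[R]_d).
Implicit Types (f g u phi q : 'rV[R]_d -> R) (s : seq 'I_d).
Implicit Types (v w : 'I_d -> 'rV[R]_d -> R).

(* Elements of function spaces over [Omega] are represented by functions on the
   whole space; only their restrictions to [Omega] (to its closure, where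
   continuity up to the boundary is required) are relevant. *)
Definition L2 : set ('rV[R]_d -> R) :=
  [set f : 'rV[R]_d -> R | measurable_fun Omega f /\
           (lebesgue_rV R d).-integrable Omega (fun x => (f x ^+ 2)%:E)].

Definition ip f g : R := \int[lebesgue_rV R d]_(x in Omega) (f x * g x).

Definition L2norm f : R := Num.sqrt (ip f f).

Definition L20 : set ('rV[R]_d -> R) :=
  [set q : 'rV[R]_d -> R | L2 q /\ \int[lebesgue_rV R d]_(x in Omega) q x = 0].

Definition partial (i : 'I_d) phi : 'rV[R]_d -> R :=
  fun x => 'D_(delta_mx 0 i) phi x.

Definition partials s phi : 'rV[R]_d -> R := foldr partial phi s.

Definition smooth phi : Prop :=
  forall s, continuous (partials s phi) /\
            forall i x, derivable (partials s phi) x (delta_mx 0 i).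

Definition test_fun : set ('rV[R]_d -> R) :=
  [set phi : 'rV[R]_d -> R | smooth phi /\
     exists K, [/\ compact K, K `<=` Omega & forall x, ~ K x -> phi x = 0]].

(* [s] lists the directions of differentiation, with repetition. *)
Definition weak_deriv s u g : Prop :=
  L2 g /\ forall phi, test_fun phi ->
    ip u (partials s phi) = (-1) ^+ size s * ip g phi.

Definition wderiv s u : 'rV[R]_d -> R := xget (fun=> 0) (weak_deriv s u).

Definition Hm (m : nat) : set ('rV[R]_d -> R) :=
  [set u : 'rV[R]_d -> R | L2 u /\
     forall s, (size s <= m)%N -> exists g, weak_deriv s u g].

Definition word (m : nat) (alpha : {ffun 'I_d -> 'I_m.+1}) : seq 'I_d :=
  flatten [seq nseq (alpha i) i | i <- enum 'I_d].

(* The sum is over the multi-indices of length at most [m]. *)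
Definition Hnorm (m : nat) u : R :=
  Num.sqrt (\sum_(alpha : {ffun 'I_d -> 'I_m.+1} | (\sum_i alpha i <= m)%N)
    L2norm (wderiv (word alpha) u) ^+ 2).

Definition H10 : set ('rV[R]_d -> R) :=
  [set u : 'rV[R]_d -> R | Hm 1 u /\
     exists phi : nat -> 'rV[R]_d -> R, (forall n, test_fun (phi n)) /\
       (fun n => Hnorm 1 (fun x => u x - phi n x)) @ \oo --> (0 : R)].

Definition ipH v w : R := \sum_i ip (v i) (w i).

Definition normH v : R := Num.sqrt (ipH v v).

Definition Hnormv (m : nat) v : R := Num.sqrt (\sum_i Hnorm m (v i) ^+ 2).

Definition spaceV : set ('I_d -> 'rV[R]_d -> R) :=
  [set v : 'I_d -> 'rV[R]_d -> R | forall i, H10 (v i)].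

Definition div v : 'rV[R]_d -> R := fun x => \sum_i wderiv [:: i] (v i) x.

Definition forma (nu : R) v w : R :=
  \sum_i \sum_j ip (fun x => nu * wderiv [:: j] (v i) x) (wderiv [:: j] (w i)).

Definition formb q v : R := - ip q (div v).

Definition normV (nu : R) v : R := Num.sqrt (forma nu v v).

Definition normQ (nu : R) q : R := L2norm (fun x => (Num.sqrt nu)^-1 * q x).

End Sobolev.

Section FiniteElements.
Variables (R : realType) (d : nat) (Omega : set 'rV[R]_d).
Implicit Types (T : seq 'M[R]_(d.+1, d)) (p q : 'rV[R]_d -> R).

(* [f] agrees on [A] with a polynomial of total degree at most [k]. *)
Definition poly_on (k : nat) (A : set 'rV[R]_d) (f : 'rV[R]_d -> R) : Prop :=
  exists c : {ffun 'I_d -> 'I_k.+1} -> R, forall x, A x ->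
    f x = \sum_(alpha : {ffun 'I_d -> 'I_k.+1} | (\sum_i alpha i <= k)%N)
            c alpha * \prod_i x 0 i ^+ alpha i.

Definition Xh T (k : nat) : set ('rV[R]_d -> R) :=
  [set f : 'rV[R]_d -> R | {within closure Omega, continuous f} /\
           forall K, K \in T -> poly_on k (simplex K) f].

Definition Vh T (k : nat) : set ('I_d -> 'rV[R]_d -> R) :=
  [set v : 'I_d -> 'rV[R]_d -> R | (forall i, Xh T k (v i)) /\ spaceV Omega v].

Definition Mh T (l : nat) : set ('rV[R]_d -> R) :=
  [set q : 'rV[R]_d -> R | L2 Omega q /\ forall K, K \in T -> poly_on l (simplex K)° q].

(* [cont] selects the continuous version of the pressure space. *)
Definition Qh T (l : nat) (cont : bool) : set ('rV[R]_d -> R) :=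
  [set q : 'rV[R]_d -> R | [/\ Mh T l q, L20 Omega q &
               cont -> {within closure Omega, continuous q}]].

Definition seminorm_j (j : ('rV[R]_d -> R) -> ('rV[R]_d -> R) -> R) q : R :=
  Num.sqrt (j q q).

(* Linearity in the second argument follows from symmetry. *)
Definition stabilization (nu : R) (Th : R -> seq 'M[R]_(d.+1, d)) (l : nat)
    (cont : bool) (j : R -> ('rV[R]_d -> R) -> ('rV[R]_d -> R) -> R) : Prop :=
  (forall h, 0 < h <= 1 ->
    [/\ forall (c : R) p q r, Qh (Th h) l cont p -> Qh (Th h) l cont q ->
          Qh (Th h) l cont r ->
          j h (fun x => c * p x + q x) r = c * j h p r + j h q r,
        forall p q, Qh (Th h) l cont p -> Qh (Th h) l cont q ->
          j h p q = j h q p &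
        forall p, Qh (Th h) l cont p -> 0 <= j h p p]) /\
  exists2 C : R, 0 < C &
    forall h p q, 0 < h <= 1 -> Qh (Th h) l cont p -> Qh (Th h) l cont q ->
      `|j h p q| <= seminorm_j (j h) p * seminorm_j (j h) q
                 <= C * normQ Omega nu p * normQ Omega nu q.

(* [lbar] is the order of weak consistency of [j]; [r] starts at [1] because
   the velocities considered are in [H^1]. *)
Definition quasi_interpolation (nu : R) (Th : R -> seq 'M[R]_(d.+1, d))
    (k l lbar : nat) (cont : bool)
    (j : R -> ('rV[R]_d -> R) -> ('rV[R]_d -> R) -> R) : Prop :=
  exists (C : R)
         (Ip : R -> ('rV[R]_d -> R) -> 'rV[R]_d -> R)
         (Iu : R -> ('I_d -> 'rV[R]_d -> R) -> 'I_d -> 'rV[R]_d -> R),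
  0 < C /\ forall h, 0 < h <= 1 ->
  [/\ (forall q, L20 Omega q -> Qh (Th h) l cont (Ip h q)) /\
      (forall v, spaceV Omega v -> Vh (Th h) k (Iu h v)),
      (forall (s : nat) q, (1 <= s)%N -> L20 Omega q -> Hm Omega s q ->
        let sp := minn s (minn lbar l.+1) in
        seminorm_j (j h) (Ip h q)
          <= C * (Num.sqrt nu)^-1 * h ^+ sp * Hnorm Omega sp q),
      (forall q, L20 Omega q -> Hm Omega l.+1 q ->
        normQ Omega nu (fun x => q x - Ip h q x)
          <= C * (Num.sqrt nu)^-1 * h ^+ l.+1 * Hnorm Omega l.+1 q),
      (forall (r : nat) v, (1 <= r)%N -> spaceV Omega v ->
        (forall i, Hm Omega r (v i)) ->
        let ru := minn r k.+1 in
        let e := fun i x => v i x - Iu h v i x in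
        normH Omega e + h * (Num.sqrt nu)^-1 * normV Omega nu e
          <= C * h ^+ ru * Hnormv Omega ru v) &
      (forall q v, Qh (Th h) l cont q -> spaceV Omega v ->
        let e := fun i x => v i x - Iu h v i x in
        `|formb Omega q e|
          <= C * seminorm_j (j h) q *
             (Num.sqrt nu * normH Omega (fun i x => h^-1 * e i x)
              + normV Omega nu e))].

End FiniteElements.

Section BDF.
Variables (R : realType) (d : nat).

Definition bdf_coef (q i : nat) : R :=
  (\sum_(1 <= m < q.+1) m%:R^-1 *: (1 - 'X) ^+ m : {poly R})`_i.

Definition bdf (q : nat) (tau : R) (w : nat -> 'I_d -> 'rV[R]_d -> R)
    (n : nat) : 'I_d -> 'rV[R]_d -> R :=
  fun c x => tau^-1 * \sum_(i < q.+1) bdf_coef q i * w (n - i)%N c x.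

(* The argument [w] is the sequence of the norms of the terms. *)
Definition l2norm (q N : nat) (tau : R) (w : nat -> R) : R :=
  Num.sqrt (tau * \sum_(q <= n < N.+1) w n ^+ 2).

(* Continuity on [[0, T]] with values in [[L^2(Omega)]^d]. *)
Definition continuous_L2 (Omega : set 'rV[R]_d) (T : R)
    (f : R -> 'I_d -> 'rV[R]_d -> R) : Prop :=
  (forall t i, 0 <= t <= T -> L2 Omega (f t i)) /\
  forall t, 0 <= t <= T -> forall eps : R, 0 < eps ->
  exists2 delta : R, 0 < delta & forall s, 0 <= s <= T -> `|s - t| < delta ->
    normH Omega (fun i x => f s i x - f t i x) < eps.

End BDF.

(* Main.v *)
Require Import Defs.
From HB Require Import structures.
From mathcomp Require Import all_boot all_order all_algebra.
From mathcomp Require Import all_classical all_reals all_analysis.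
From mathcomp Require Import measurable_realfun ring lra.
Import Order.TTheory GRing.Theory Num.Theory.
Import numFieldNormedType.Exports.
Local Open Scope classical_set_scope.
Local Open Scope ring_scope.
Set Implicit Arguments. Unset Strict Implicit. Unset Printing Implicit Defensive.

(* The momentum equation at step [n], tested separately with the functions
   [u_(m-i)] and summed with the BDF weights, reads
   [tau (d_n, d_m) + \sum_i delta_i A(n, m - i) = tau (f_n, d_m)], where [d_n] is
   the discrete derivative and [A(n, m) = a(u_n, u_m) + j(p_n, p_m)] is a Gram
   matrix: the divergence constraint, which holds at every time level, turns
   [b(p_n, u_m)] into [j(p_m, p_n)].  Only the positivity of [A] is used.  The
   equation at [n] minus [19/20] times the one at [n - 1], both tested at [n], is
   controlled by G-stability of BDF-[q] with the Nevanlinna-Odeh multiplier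
   [1 - 19/20 zeta]: the [A]-terms dominate an increment [E_n - E_(n-1)] of a
   positive definite quadratic form in [(u, p)_n, ..., (u, p)_(n-q+1)].
   Summation telescopes, without any Gronwall argument.  The first step [n = q]
   is tested with [d_q] directly. *)

(** * G-stability *)

Lemma bdf_coefE (R : realType) (q i : nat) :
  bdf_coef R q i = \sum_(1 <= m < q.+1) (-1) ^+ i * 'C(m, i)%:R / m%:R.
Proof.
rewrite /bdf_coef coef_sum; apply: eq_bigr => m _.
rewrite coefZ mulrC; congr (_ * _).
have -> : (1 - 'X : {poly R}) = 1 + (-1) *: 'X by rewrite scaleN1r.
rewrite exprDn coef_sum.
have [im|im] := leqP m.+1 i.
  rewrite bin_small// mulr0 big1// => -[k /= km] _.
  rewrite coefMn expr1n mul1r exprZn coefZ coefXn.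
  by rewrite gtn_eqF ?mulr0 ?mul0rn// (leq_trans km im).
rewrite (bigD1 (Ordinal im)) //= big1 ?addr0.
  by rewrite coefMn expr1n mul1r exprZn coefZ coefXn eqxx mulr1 mulr_natr.
move=> k ki; rewrite coefMn expr1n mul1r exprZn coefZ coefXn.
rewrite (_ : (i == k) = false) ?mulr0 ?mul0rn//.
by apply: contraNF ki => /eqP ik; apply/eqP/val_inj.
Qed.

(** Abstracts the matrix of inner products of an infinite sequence of vectors. A combination is a
    list of weighted indices, in which an index may repeat, so that positivity survives every
    re-indexing, injective or not. *)
Definition gram_psd (R : realType) (g : nat -> nat -> R) : Prop :=
  (forall i k, g i k = g k i) /\
  forall s : seq (R * nat),
    0 <= \sum_(a <- s) \sum_(b <- s) a.1 * b.1 * g a.2 b.2.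

(* The matrix [G] of the energy for the multiplier [1 - 19/20 zeta].  Consistency
   forces the row sums of [G] to be [1/40] times the partial sums of the BDF
   coefficients; the remaining freedom was fixed by solving the semidefinite
   program of G-stability numerically and rounding. *)
Definition bdf_gram (R : realType) (q : nat) : seq (seq R) :=
  match q with
  | 1 => [:: [:: 1 / 40]]
  | 2 => [:: [:: 83 / 80; - 1];
            [:: - 1; 79 / 80]]
  | 3 => [:: [:: 331 / 240; - (5 / 3); 1 / 3];
            [:: - (5 / 3); 553 / 240; - (2 / 3)];
            [:: 1 / 3; - (2 / 3); 41 / 120]]
  | 4 => [:: [:: 55 / 32; - (7 / 3); 1; - (1 / 3)];
            [:: - (7 / 3); 1897 / 480; - (7 / 3); 2 / 3];
            [:: 1; - (7 / 3); 973 / 480; - (2 / 3)];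
            [:: - (1 / 3); 2 / 3; - (2 / 3); 157 / 480]]
  | 5 => [:: [:: 5017 / 2400; - (16 / 5); 31 / 15; - (37 / 30); 1 / 3];
            [:: - (16 / 5); 13997 / 2400; - (64 / 15); 71 / 30; - (4 / 5)];
            [:: 31 / 15; - (64 / 15); 3059 / 800; - (7 / 3); 23 / 30];
            [:: - (37 / 30); 71 / 30; - (7 / 3); 4577 / 2400; - (11 / 15)];
            [:: 1 / 3; - (4 / 5); 23 / 30; - (11 / 15); 263 / 600]]
  | _ => [::]
  end.

(** Index [0] stands for the current time level and [i] for the level [i] steps back. *)
Definition bdf_energy (R : realType) (q : nat) (a : nat -> nat -> R) : R :=
  \sum_(i < q) \sum_(k < q) nth 0 (nth [::] (bdf_gram R q) i) k * a i k.

Lemma gram_psd_comp (R : realType) (g : nat -> nat -> R) (x : nat -> nat) :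
  gram_psd g -> gram_psd (fun i k => g (x i) (x k)).
Proof.
move=> [gC gP]; split=> [i k|s]; first exact: gC.
have := gP [seq (a.1, x a.2) | a <- s]; rewrite big_map.
by under eq_bigr do rewrite big_map.
Qed.

(** The squared length of a combination of six vectors: one BDF-5 step couples the levels [n + 1]
    down to [n - 4]. Written out in the upper triangular entries, it is linear in them once the
    coefficients are numerals, which is the form [lra] needs. *)
Lemma gram_psd6 (R : realType) (a : nat -> nat -> R) (c0 c1 c2 c3 c4 c5 : R) :
  gram_psd a ->
  0 <= c0 ^+ 2 * a 0%N 0%N + c1 ^+ 2 * a 1%N 1%N + c2 ^+ 2 * a 2%N 2%N
       + c3 ^+ 2 * a 3%N 3%N + c4 ^+ 2 * a 4%N 4%N + c5 ^+ 2 * a 5%N 5%N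
       + 2 * (c0 * c1 * a 0%N 1%N + c0 * c2 * a 0%N 2%N + c0 * c3 * a 0%N 3%N
              + c0 * c4 * a 0%N 4%N + c0 * c5 * a 0%N 5%N + c1 * c2 * a 1%N 2%N
              + c1 * c3 * a 1%N 3%N + c1 * c4 * a 1%N 4%N + c1 * c5 * a 1%N 5%N
              + c2 * c3 * a 2%N 3%N + c2 * c4 * a 2%N 4%N + c2 * c5 * a 2%N 5%N
              + c3 * c4 * a 3%N 4%N + c3 * c5 * a 3%N 5%N + c4 * c5 * a 4%N 5%N).
Proof.
move=> [aC aP].
have := aP [:: (c0, 0%N); (c1, 1%N); (c2, 2%N); (c3, 3%N); (c4, 4%N); (c5, 5%N)].
rewrite !(big_cons, big_nil) /=.
rewrite (aC 1%N 0%N) (aC 2%N 0%N) (aC 3%N 0%N) (aC 4%N 0%N) (aC 5%N 0%N)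
  (aC 2%N 1%N) (aC 3%N 1%N) (aC 4%N 1%N) (aC 5%N 1%N) (aC 3%N 2%N)
  (aC 4%N 2%N) (aC 5%N 2%N) (aC 4%N 3%N) (aC 5%N 3%N) (aC 5%N 4%N) {aC aP}.
move: (a 0%N 0%N) (a 0%N 1%N) (a 0%N 2%N) (a 0%N 3%N) (a 0%N 4%N) (a 0%N 5%N)
  (a 1%N 1%N) (a 1%N 2%N) (a 1%N 3%N) (a 1%N 4%N) (a 1%N 5%N) (a 2%N 2%N)
  (a 2%N 3%N) (a 2%N 4%N) (a 2%N 5%N) (a 3%N 3%N) (a 3%N 4%N) (a 3%N 5%N)
  (a 4%N 4%N) (a 4%N 5%N) (a 5%N 5%N) => {}a *.
nra.
Qed.

Definition bdf_table (R : realType) (q : nat) : seq R :=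
  match q with
  | 1 => [:: 1; - 1]
  | 2 => [:: 3 / 2; - 2; 1 / 2]
  | 3 => [:: 11 / 6; - 3; 3 / 2; - (1 / 3)]
  | 4 => [:: 25 / 12; - 4; 3; - (4 / 3); 1 / 4]
  | 5 => [:: 137 / 60; - 5; 5; - (10 / 3); 5 / 4; - (1 / 5)]
  | _ => [::]
  end.

Lemma bdf_coef_table (R : realType) (q i : nat) :
  (1 <= q <= 5)%N -> (i <= q)%N -> bdf_coef R q i = nth 0 (bdf_table R q) i.
Proof.
rewrite bdf_coefE.
case: q => [|[|[|[|[|[|//]]]]]] // _; case: i => [|[|[|[|[|[|//]]]]]] // _.
all: rewrite /index_iota /= !(big_cons, big_nil).
(* The binomials become numerals, so that only rational arithmetic is left. *)
all: repeat match goal with |- context [binomial ?m ?n] =>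
  let v := eval vm_compute in (binomial m n) in change (binomial m n) with v end.
all: lra.
Qed.

(* In this lemma and the next one, the vectors are those of a rounded [L D L^T]
   factorization of the difference of the two sides, together with the vectors
   [e_i +- e_k], in the basis of the differences, which take care of the
   diagonally dominant rounding error; [lra] finds the nonnegative weights.
   Here the first two vectors are [s] and [2 s - x_0], where [s] is the sum with
   weights the partial sums of the BDF coefficients, since [x_0 - s] is a
   combination of differences and [x_0^2 <= 2 s^2 + 2 (x_0 - s)^2]. *)
Lemma bdf_gram_ge (R : realType) (q : nat) (a : nat -> nat -> R) :
  (1 <= q <= 5)%N -> gram_psd a -> 1000^-1 * a 0%N 0%N <= bdf_energy q a.
Proof.
move=> hq aP; have [aC _] := aP; rewrite /bdf_energy.
move: (fun c0 c1 c2 c3 c4 c5 => gram_psd6 c0 c1 c2 c3 c4 c5 aP).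
case: q hq => [|[|[|[|[|[|//]]]]]] // _.
all: rewrite !big_ord_recl !big_ord0 /= /bump /= ?addn0 ?add1n
  ?(aC 1%N 0%N) ?(aC 2%N 0%N) ?(aC 3%N 0%N) ?(aC 4%N 0%N) ?(aC 2%N 1%N)
  ?(aC 3%N 1%N) ?(aC 4%N 1%N) ?(aC 3%N 2%N) ?(aC 4%N 2%N) ?(aC 4%N 3%N)
  {aC aP}.
all: move: (a 0%N 0%N) (a 0%N 1%N) (a 0%N 2%N) (a 0%N 3%N) (a 0%N 4%N)
  (a 0%N 5%N) (a 1%N 1%N) (a 1%N 2%N) (a 1%N 3%N) (a 1%N 4%N) (a 1%N 5%N)
  (a 2%N 2%N) (a 2%N 3%N) (a 2%N 4%N) (a 2%N 5%N) (a 3%N 3%N) (a 3%N 4%N)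
  (a 3%N 5%N) (a 4%N 4%N) (a 4%N 5%N) (a 5%N 5%N) =>
  {a} a00 a01 a02 a03 a04 a05 a11 a12 a13 a14 a15
  a22 a23 a24 a25 a33 a34 a35 a44 a45 a55 P.
- move: (P 1 0 0 0 0 0); lra.
- move: (P (3 / 2) (- (1 / 2)) 0 0 0 0) (P 2 (- 1) 0 0 0 0) (P 1 (- 1) 0 0 0 0);
    lra.
- move: (P (11 / 6) (- (7 / 6)) (1 / 3) 0 0 0)
    (P (8 / 3) (- (7 / 3)) (2 / 3) 0 0 0) (P 1 (- (4 / 3)) (1 / 3) 0 0 0)
    (P 1 (- 1) 0 0 0 0) (P 1 0 (- 1) 0 0 0) (P 0 1 (- 1) 0 0 0); lra.
- move: (P (25 / 12) (- (23 / 12)) (13 / 12) (- (1 / 4)) 0 0)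
    (P (19 / 6) (- (23 / 6)) (13 / 6) (- (1 / 2)) 0 0)
    (P 1 (- (4 / 3)) (2 / 3) (- (1 / 3)) 0 0) (P 0 1 (- (4 / 3)) (1 / 3) 0 0)
    (P 1 (- 1) 0 0 0 0) (P (- 1) 2 (- 1) 0 0 0) (P 0 1 (- 1) 0 0 0)
    (P (- 1) 1 1 (- 1) 0 0) (P 0 (- 1) 2 (- 1) 0 0) (P 0 0 1 (- 1) 0 0); lra.
- move: (P (137 / 60) (- (163 / 60)) (137 / 60) (- (21 / 20)) (1 / 5) 0)
    (P (107 / 30) (- (163 / 30)) (137 / 30) (- (21 / 10)) (2 / 5) 0)
    (P 1 (- (8 / 5)) 1 (- (3 / 5)) (1 / 5) 0)
    (P 0 1 (- (6 / 5)) (3 / 5) (- (2 / 5)) 0) (P 1 (- 1) 0 0 0 0)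
    (P (- 1) 2 (- 1) 0 0 0) (P 0 1 (- 1) 0 0 0) (P 1 (- 1) 1 (- 1) 0 0)
    (P 0 (- 1) 2 (- 1) 0 0) (P 0 0 1 (- 1) 0 0) (P (- 1) 1 0 1 (- 1) 0)
    (P 0 1 (- 1) 1 (- 1) 0) (P 0 0 (- 1) 2 (- 1) 0) (P 0 0 0 1 (- 1) 0); lra.
Qed.

Lemma bdf_gram_step (R : realType) (q : nat) (a : nat -> nat -> R) :
  (1 <= q <= 5)%N -> gram_psd a ->
  bdf_energy q a - bdf_energy q (fun i k => a i.+1 k.+1)
    <= \sum_(i < q.+1) bdf_coef R q i * (a 0%N i - 19 / 20 * a 1%N i).
Proof.
move=> hq aP; have [aC _] := aP; rewrite /bdf_energy.
have -> : \sum_(i < q.+1) bdf_coef R q i * (a 0%N i - 19 / 20 * a 1%N i)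
    = \sum_(i < q.+1) nth 0 (bdf_table R q) i * (a 0%N i - 19 / 20 * a 1%N i).
  by apply: eq_bigr => i _; rewrite bdf_coef_table // -ltnS.
move: (fun c0 c1 c2 c3 c4 c5 => gram_psd6 c0 c1 c2 c3 c4 c5 aP).
case: q hq => [|[|[|[|[|[|//]]]]]] // _.
all: rewrite !big_ord_recl !big_ord0 /= /bump /= ?addn0 ?add1n
  ?(aC 1%N 0%N) ?(aC 2%N 0%N) ?(aC 3%N 0%N) ?(aC 4%N 0%N) ?(aC 5%N 0%N)
  ?(aC 2%N 1%N) ?(aC 3%N 1%N) ?(aC 4%N 1%N) ?(aC 5%N 1%N) ?(aC 3%N 2%N)
  ?(aC 4%N 2%N) ?(aC 5%N 2%N) ?(aC 4%N 3%N) ?(aC 5%N 3%N) ?(aC 5%N 4%N)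
  {aC aP}.
all: move: (a 0%N 0%N) (a 0%N 1%N) (a 0%N 2%N) (a 0%N 3%N) (a 0%N 4%N)
  (a 0%N 5%N) (a 1%N 1%N) (a 1%N 2%N) (a 1%N 3%N) (a 1%N 4%N) (a 1%N 5%N)
  (a 2%N 2%N) (a 2%N 3%N) (a 2%N 4%N) (a 2%N 5%N) (a 3%N 3%N) (a 3%N 4%N)
  (a 3%N 5%N) (a 4%N 4%N) (a 4%N 5%N) (a 5%N 5%N) =>
  {a} a00 a01 a02 a03 a04 a05 a11 a12 a13 a14 a15
  a22 a23 a24 a25 a33 a34 a35 a44 a45 a55 P.
(* Both sides vanish when all entries of [a] are equal, because the BDF coefficients sum to zero;
   accordingly every vector below has coefficient sum zero. *)
- move: (P 1 (- 1) 0 0 0 0); lra.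
- move: (P 1 (- 1) 0 0 0 0) (P (- 1) 2 (- 1) 0 0 0) (P 0 1 (- 1) 0 0 0); lra.
- move: (P 1 (- (3 / 2)) 1 (- (1 / 2)) 0 0) (P 0 1 (- (3 / 2)) (1 / 2) 0 0)
    (P 1 (- 1) 0 0 0 0) (P (- 1) 2 (- 1) 0 0 0) (P 0 1 (- 1) 0 0 0)
    (P 0 1 0 (- 1) 0 0); lra.
- move: (P 1 (- 2) (7 / 4) (- (5 / 4)) (1 / 2) 0)
    (P 0 1 (- (3 / 2)) (5 / 4) (- (3 / 4)) 0) (P 0 0 1 (- (3 / 2)) (1 / 2) 0)
    (P 1 (- 1) 0 0 0 0) (P (- 1) 2 (- 1) 0 0 0) (P 0 1 (- 1) 0 0 0)
    (P 1 (- 1) 1 (- 1) 0 0) (P 0 1 0 (- 1) 0 0) (P 0 0 1 (- 1) 0 0)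
    (P 0 1 (- 1) 1 (- 1) 0) (P 0 0 (- 1) 2 (- 1) 0) (P 0 0 0 1 (- 1) 0); lra.
- move: (P 1 (- (17 / 8)) (5 / 2) (- (5 / 2)) (7 / 4) (- (5 / 8)))
    (P 0 1 (- (15 / 8)) (15 / 8) (- (17 / 8)) (9 / 8))
    (P 0 0 1 (- (3 / 4)) (1 / 2) (- (3 / 4))) (P 1 (- 1) 0 0 0 0)
    (P (- 1) 2 (- 1) 0 0 0) (P 0 1 (- 1) 0 0 0) (P 1 (- 1) 1 (- 1) 0 0)
    (P 0 (- 1) 2 (- 1) 0 0) (P 0 0 1 (- 1) 0 0) (P (- 1) 1 0 1 (- 1) 0)
    (P 0 1 (- 1) 1 (- 1) 0) (P 0 0 (- 1) 2 (- 1) 0) (P 0 0 0 1 (- 1) 0)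
    (P (- 1) 1 0 0 1 (- 1)) (P 0 1 (- 1) 0 1 (- 1)) (P 0 0 1 (- 1) 1 (- 1))
    (P 0 0 0 1 0 (- 1)) (P 0 0 0 0 1 (- 1)); lra.
Qed.

(** * The energy estimate *)

(** The leading coefficient is the harmonic sum [1 + 1/2 + ... + 1/q]. *)
Lemma bdf_coef0_gt0 (R : realType) (q : nat) :
  (1 <= q)%N -> 0 < bdf_coef R q 0.
Proof.
move=> q0; rewrite bdf_coefE big_ltn ?ltnS// expr0 bin0 mul1r.
rewrite ltr_wpDr ?divr_gt0//; apply: sumr_ge0 => m _.
by rewrite bin0 mul1r divr_ge0.
Qed.

(** This is the squared length of [v_i + c v_k]. *)
Lemma gram_young (R : realType) (g : nat -> nat -> R) (c : R) (i k : nat) :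
  gram_psd g -> 0 <= g i i + 2 * c * g i k + c ^+ 2 * g k k.
Proof.
move=> [gC gP]; have := gP [:: (1, i); (c, k)].
by rewrite !(big_cons, big_nil) /= (gC k i); congr (_ <= _); ring.
Qed.

Lemma gram_diag_ge0 (R : realType) (g : nat -> nat -> R) (i : nat) :
  gram_psd g -> 0 <= g i i.
Proof.
by move=> /(gram_young 0 i i); rewrite mulr0 mul0r addr0 expr2 !mul0r addr0.
Qed.

Lemma gram_young_norm (R : realType) (g : nat -> nat -> R) (i k : nat) (c s : R) :
  0 < s -> gram_psd g -> `|c * g i k| <= s * g i i + c ^+ 2 / (4 * s) * g k k.
Proof.
move=> s0 gP.
have H (c' : R) : - (c' * g i k) <= s * g i i + c' ^+ 2 / (4 * s) * g k k.
  rewrite -subr_ge0.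
  (* Completing the square: the vector is [v_i + c' / (2 s) v_k]. *)
  rewrite (_ : _ - _ = s * (g i i + 2 * (c' / (2 * s)) * g i k
                            + (c' / (2 * s)) ^+ 2 * g k k)).
    by rewrite mulr_ge0 ?gram_young// ltW.
  by field; rewrite gt_eqF.
by rewrite ler_norml; have := H c; have := H (- c); rewrite sqrrN; lra.
Qed.

Lemma bdf_energy_le (R : realType) (q : nat) :
  exists2 C : R, 0 < C & forall a : nat -> nat -> R, gram_psd a ->
    bdf_energy q a <= C * \sum_(i < q) a i i.
Proof.
pose G (i k : nat) : R := nth 0 (nth [::] (bdf_gram R q) i) k.
(* Young's inequality with [s = 1] bounds each entry by [1 + G i k ^+ 2] times the trace; the
   leading [1] makes the constant positive in all cases. *)
exists (1 + \sum_(i < q) \sum_(k < q) (1 + G i k ^+ 2)).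
  rewrite ltr_wpDr//; apply: sumr_ge0 => i _; apply: sumr_ge0 => k _.
  by rewrite addr_ge0// sqr_ge0.
move=> a aP; have a0 i : 0 <= a i i by exact: gram_diag_ge0.
have S0 : 0 <= \sum_(i < q) a i i by exact: sumr_ge0.
have aS (i : 'I_q) : a i i <= \sum_(i < q) a i i.
  by rewrite (bigD1 i)//= lerDl sumr_ge0.
rewrite /bdf_energy mulrDl mul1r ler_wpDl// mulr_suml.
apply: ler_sum => i _; rewrite mulr_suml; apply: ler_sum => k _.
apply: (le_trans (ler_norm _)).
apply: (le_trans (gram_young_norm i k (G i k) ltr01 aP)).
rewrite (mulrDl 1 (G i k ^+ 2)); apply: lerD; first by rewrite !mul1r.
apply: ler_pM => //; last by rewrite mulr1 ler_pdivrMr// ler_peMr ?sqr_ge0// ler1n.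
by rewrite divr_ge0// ?sqr_ge0// mulr1.
Qed.

(** At the first step there is no earlier equation to combine with, so the positive leading
    coefficient alone controls the new level, at the price of the [q] initial ones. *)
Lemma bdf_first_step (R : realType) (q : nat) : (1 <= q)%N ->
  exists c C : R, [/\ 0 < c, 0 < C & forall a : nat -> nat -> R, gram_psd a ->
    c * a 0%N 0%N - C * \sum_(1 <= i < q.+1) a i i
      <= \sum_(i < q.+1) bdf_coef R q i * a 0%N i].
Proof.
move=> q0; have d0 := bdf_coef0_gt0 R q0; pose d := bdf_coef R q.
(* Each of the [q] cross terms takes this share of [a 0 0]; together they use half of the leading
   coefficient. *)
pose s : R := d 0%N / (2 * q%:R).
have q0R : (0 : R) < q%:R by rewrite ltr0n.
have s0 : 0 < s by rewrite divr_gt0// mulr_gt0.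
exists (d 0%N / 2), (1 + \sum_(1 <= i < q.+1) d i ^+ 2 / (4 * s)).
have D0 : 0 <= \sum_(1 <= i < q.+1) d i ^+ 2 / (4 * s).
  by apply: sumr_ge0 => i _; rewrite divr_ge0 ?sqr_ge0// mulr_ge0// ltW.
split; [by rewrite divr_gt0| lra |move=> a aP].
have a0 i : 0 <= a i i by exact: gram_diag_ge0.
rewrite -(big_mkord xpredT (fun i => bdf_coef R q i * a 0%N i)) big_ltn// -!/(d _).
have H : - \sum_(1 <= i < q.+1) d i * a 0%N i <=
    \sum_(1 <= i < q.+1) (s * a 0%N 0%N + d i ^+ 2 / (4 * s) * a i i).
  rewrite -sumrN; apply: ler_sum => i _.
  apply: le_trans (gram_young_norm 0 i (d i) s0 aP).
  by rewrite -normrN ler_norm.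
have K : \sum_(1 <= i < q.+1) (s * a 0%N 0%N + d i ^+ 2 / (4 * s) * a i i)
   <= d 0%N / 2 * a 0%N 0%N + (\sum_(1 <= i < q.+1) d i ^+ 2 / (4 * s))
       * \sum_(1 <= i < q.+1) a i i.
  rewrite big_split /=; apply: lerD.
    rewrite sumr_const_nat subSS subn0 -mulr_natr /s.
    by rewrite le_eqVlt; apply/orP; left; apply/eqP; field; rewrite gt_eqF.
  rewrite mulr_suml big_nat_cond [leRHS]big_nat_cond.
  apply: ler_sum => i /andP[iq _]; apply: ler_wpM2l.
    by rewrite divr_ge0 ?sqr_ge0// mulr_ge0// ltW.
  rewrite (bigD1_seq i) ?mem_index_iota ?iota_uniq//= lerDl.
  by apply: sumr_ge0.
have S0 : 0 <= \sum_(1 <= i < q.+1) a i i by exact: sumr_ge0.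
lra.
Qed.

(* To be read with [A] the Gram matrix of the pairs [(u_n, p_n)],
   [D n m = (d_n, d_m)], [F n m = (f_n, d_m)] and [Fn n = (f_n, f_n)]. *)
Lemma bdf_recursion (R : realType) (q n : nat) (A D F : nat -> nat -> R)
    (Fn : nat -> R) (tau : R) :
  (1 <= q <= 5)%N -> 0 < tau -> gram_psd A -> gram_psd D ->
  (forall n m c, 0 <= Fn n + 2 * c * F n m + c ^+ 2 * D m m) ->
  (forall m, (n <= m <= n.+1)%N ->
    tau * D m n.+1 + \sum_(i < q.+1) bdf_coef R q i * A m (n.+1 - i)%N
    = tau * F m n.+1) ->
  let E m :=
    bdf_energy q (fun i k => A (m - i)%N (m - k)%N) + tau * (19 / 40) * D m m in
  E n.+1 + 3 / 80 * tau * D n.+1 n.+1 <= E n + 40 * tau * (Fn n.+1 + Fn n).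
Proof.
move=> hq tau0 AP DP FP H /=.
have := bdf_gram_step hq (gram_psd_comp (fun i => n.+1 - i)%N AP).
rewrite subn0 subn1 /=.
have -> : \sum_(i < q.+1) bdf_coef R q i
     * (A n.+1 (n.+1 - i)%N - 19 / 20 * A n (n.+1 - i)%N)
   = tau * (F n.+1 n.+1 - D n.+1 n.+1) - 19 / 20 * (tau * (F n n.+1 - D n n.+1)).
  rewrite !mulrBr -(H n.+1) ?leqnSn ?leqnn// -(H n) ?leqnSn ?leqnn//.
  have -> : \sum_(i < q.+1) bdf_coef R q i
       * (A n.+1 (n.+1 - i)%N - 19 / 20 * A n (n.+1 - i)%N)
    = \sum_(i < q.+1) bdf_coef R q i * A n.+1 (n.+1 - i)%N
      - 19 / 20 * \sum_(i < q.+1) bdf_coef R q i * A n (n.+1 - i)%N.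
    by rewrite mulr_sumr -sumrB; apply: eq_bigr => i _; rewrite mulrBr mulrCA.
  lra.
rewrite -[bdf_energy q (fun i k => A (n.+1 - i.+1)%N _)]
  /(bdf_energy q (fun i k => A (n - i)%N (n - k)%N)).
set E1 := bdf_energy _ _; set E0 := bdf_energy _ _ => HE.
have Y : E1 - E0 <=
    tau * ((F n.+1 n.+1 - D n.+1 n.+1) - 19 / 20 * (F n n.+1 - D n n.+1)).
  lra.
(* Young's inequality turns the cross term [19/20 D n n.+1] into [19/40] at each level; the one at
   [n] is the term carried in [E n]. The forcing terms cost [1/160] of [D n.+1 n.+1] or less each.
   What remains, [41/80], exceeds [19/40] by the dissipation [3/80] of the conclusion. *)
have Z : (F n.+1 n.+1 - D n.+1 n.+1) - 19 / 20 * (F n n.+1 - D n n.+1)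
    <= 40 * (Fn n.+1 + Fn n) + 19 / 40 * D n n - 41 / 80 * D n.+1 n.+1.
  have := FP n.+1 n.+1 (- (1 / 80)); have := FP n n.+1 (1 / 80).
  have := gram_young (- 1) n n.+1 DP.
  have := FP n n.+1 0; have := gram_diag_ge0 n.+1 DP.
  lra.
have := le_trans Y (ler_wpM2l (ltW tau0) Z).
rewrite -/E1 -/E0; lra.
Qed.

(** The theorem in abstract form. [C] is chosen from [q] alone, before the matrices, [tau] and [N],
    which is where its independence of the mesh and of the final time comes from. *)
Lemma bdf_estimate (R : realType) (q : nat) : (1 <= q <= 5)%N ->
  exists2 C : R, 0 < C &
  forall (A D F : nat -> nat -> R) (Fn : nat -> R) (tau : R) (N : nat),
  (q <= N)%N -> 0 < tau -> gram_psd A -> gram_psd D ->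
  (forall n m c, 0 <= Fn n + 2 * c * F n m + c ^+ 2 * D m m) ->
  (forall n m, (q <= n <= N)%N -> (q <= m <= N)%N ->
    tau * D n m + \sum_(i < q.+1) bdf_coef R q i * A n (m - i)%N = tau * F n m) ->
  tau * \sum_(q <= n < N.+1) D n n + A N N
    <= C * (\sum_(i < q) A i i + tau * \sum_(q <= n < N.+1) Fn n).
Proof.
move=> hq; have q0 : (1 <= q)%N by case/andP: hq.
have [c [C0 [c0 C00 first]]] := bdf_first_step R q0.
have [CE CE0 EC] := bdf_energy_le R q.
(* [K] multiplies the first-step bound: [CE / c] serves the energy of level [q], and [1] its [D q q]
   term. [B] collects the factors of the data in the bound on [E q] plus the forcing. *)
pose K := CE / c + 1; pose B := K * C0 + CE + K + 80.
have K0 : 0 < K by rewrite addr_gt0// divr_gt0.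
have KC0 : 0 < K * C0 by exact: mulr_gt0.
have B0 : 0 < B by rewrite /B; lra.
(* [2 * C0 + 1] is for [D q q]; [1027] is [1000] for [A N N], from the lower bound on the energy,
   plus [27], above [80/3], for the later [D n n]. *)
exists (2 * C0 + 1 + 1027 * B) => [|A D F Fn tau N qN tau0 AP DP FP H]; first lra.
have D0 n : 0 <= D n n by exact: gram_diag_ge0.
have A0 n : 0 <= A n n by exact: gram_diag_ge0.
have Fn0 n : 0 <= Fn n by have := FP n n 0; rewrite expr2 !(mulr0, mul0r) !addr0.
pose E m :=
  bdf_energy q (fun i k => A (m - i)%N (m - k)%N) + tau * (19 / 40) * D m m.
(* Two consecutive steps share each forcing term, whence [80]; the last one has been used only once,
   and subtracting [40 * tau * Fn m] makes the induction close exactly. *)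
have rec m : (q <= m <= N)%N ->
    E m + 3 / 80 * tau * \sum_(q.+1 <= n < m.+1) D n n
      <= E q + 80 * tau * \sum_(q <= n < m.+1) Fn n - 40 * tau * Fn m.
  elim: m => [|m IH] /andP[qm mN]; first by move: q0 qm; case: (q).
  move: qm; rewrite leq_eqVlt => /predU1P[<-|].
    rewrite big_geq// big_nat1 mulr0 addr0.
    have : 0 <= tau * Fn q by rewrite mulr_ge0// ltW.
    lra.
  rewrite ltnS => qm; have {IH} := IH (introT andP (conj qm (ltnW mN))).
  have := @bdf_recursion R q m A D F Fn tau hq tau0 AP DP FP.
  have hyp k : (m <= k <= m.+1)%N ->
     tau * D k m.+1 + \sum_(i < q.+1) bdf_coef R q i * A k (m.+1 - i)%N
     = tau * F k m.+1.
    move=> /andP[mk km]; apply: H; last by rewrite (leq_trans qm)//.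
    by rewrite (leq_trans qm)//= (leq_trans km).
  move=> /(_ hyp) /=; rewrite -!/(E _).
  rewrite (big_nat_recr _ _ _ (_ : q < m.+1)%N)//=.
  rewrite (big_nat_recr _ _ _ (_ : q <= m.+1)%N) ?(leq_trans qm)//=.
  lra.
set I := \sum_(i < q) A i i.
have I0 : 0 <= I by exact: sumr_ge0.
have SI : \sum_(1 <= i < q.+1) A (q - i)%N (q - i)%N = I.
  rewrite /I -(big_mkord xpredT (fun i => A i i)) [RHS]big_nat_rev /= ?add0n big_add1 /=.
  by apply: eq_big_nat.
set SF := \sum_(q <= n < N.+1) Fn n.
have SFq : Fn q <= SF by rewrite /SF big_ltn// lerDl sumr_ge0.
(* The equation at [n = m = q], with half of [D q q] spent on the forcing. *)
have start : tau / 2 * D q q + c * A q q <= C0 * I + tau / 2 * Fn q.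
  have := first _ (gram_psd_comp (fun i => q - i)%N AP).
  rewrite subn0 SI; have := H q q; rewrite leqnn qN => /(_ isT isT).
  have : 0 <= tau * (Fn q - 2 * F q q + D q q).
    by apply: mulr_ge0; [exact: ltW|have := FP q q (-1); lra].
  lra.
have Dq : tau / 2 * D q q <= C0 * I + tau / 2 * Fn q.
  have : 0 <= c * A q q by rewrite mulr_ge0// ltW.
  lra.
have Aq : CE * A q q <= CE / c * (C0 * I + tau / 2 * Fn q).
  rewrite -mulrA ler_pM2l// ler_pdivlMl//.
  have : 0 <= tau / 2 * D q q by rewrite mulr_ge0// divr_ge0// ltW.
  lra.
have Eq : E q <= K * (C0 * I + tau / 2 * Fn q) + CE * I.
  have := EC _ (gram_psd_comp (fun i => q - i)%N AP).
  (* The energy at [q] involves the levels [q] down to [1]; adding level [0] completes the initial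
     sum. *)
  have : \sum_(i < q) A (q - i)%N (q - i)%N <= A q q + I.
    rewrite -SI -(big_mkord xpredT (fun i => A (q - i)%N (q - i)%N)).
    rewrite [leRHS](_ : _ = \sum_(0 <= i < q.+1) A (q - i)%N (q - i)%N); last first.
      by rewrite [RHS]big_ltn// subn0.
    by rewrite [leRHS]big_nat_recr//= lerDl.
  rewrite -(ler_pM2l CE0) /E /K => H1 H2.
  have : 0 <= tau * D q q by rewrite mulr_ge0// ltW.
  lra.
have last := rec N; rewrite qN leqnn in last; have {last} := last isT.
rewrite -/SF => last.
have AN : 1000^-1 * A N N <= E N.
  have := bdf_gram_ge hq (gram_psd_comp (fun i => N - i)%N AP); rewrite subn0 /E.
  have : 0 <= tau * D N N by rewrite mulr_ge0// ltW.
  lra.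
rewrite big_ltn//.
have FN0 : 0 <= tau * Fn N by rewrite mulr_ge0// ltW.
have SF0 : 0 <= tau * SF by apply: mulr_ge0; [exact: ltW|exact: sumr_ge0].
have tFq : tau * Fn q <= tau * SF by rewrite ler_pM2l.
have SD0 : 0 <= tau * \sum_(q.+1 <= n < N.+1) D n n.
  by apply: mulr_ge0; [exact: ltW|exact: sumr_ge0].
have KF : K * (tau * Fn q) <= K * (tau * SF) by rewrite ler_pM2l.
have KF0 : 0 <= K * (tau * SF) by rewrite mulr_ge0// ltW.
have bound : E q + 80 * tau * SF <= B * (I + tau * SF).
  have C1 : 0 <= (K * C0 + CE) * (tau * SF) by rewrite mulr_ge0//; lra.
  have C2 : 0 <= (K + 80) * I by rewrite mulr_ge0//; lra.
  rewrite /B; lra.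
have C1 : 0 <= C0 * (tau * SF) by rewrite mulr_ge0// ltW.
have EN0 : 0 <= E N by have := A0 N; lra.
have T1 : tau * D q q <= (2 * C0 + 1) * (I + tau * SF).
  by move: Dq tFq C1 I0; clear; lra.
have T2 : tau * \sum_(q.+1 <= n < N.+1) D n n <= 27 * (B * (I + tau * SF)).
  by move: bound last EN0 FN0 SD0; clear; lra.
have T3 : A N N <= 1000 * (B * (I + tau * SF)).
  by move: bound last AN FN0 SD0; clear; lra.
by move: T1 T2 T3; clear; lra.
Qed.

(** * Semi-inner products and their Gram matrices *)

(** Covers both [ip] on [L2] and the stabilization on [Qh]. The forms act on arbitrary functions but
    are bilinear only on the class [S], so [S] and its closure under combinations are part of the
    notion. *)
Definition semi_inner (R : realType) (X : Type) (S : set (X -> R))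
    (B : (X -> R) -> (X -> R) -> R) : Prop :=
  [/\ S (fun=> 0),
      forall (c : R) p r, S p -> S r -> S (fun x => c * p x + r x),
      forall (c : R) p r y, S p -> S r -> S y ->
        B (fun x => c * p x + r x) y = c * B p y + B r y,
      forall p r, S p -> S r -> B p r = B r p &
      forall p, S p -> 0 <= B p p].

Section SemiInner.
Variables (R : realType) (X : Type) (S : set (X -> R)).
Variable B : (X -> R) -> (X -> R) -> R.
Hypothesis SB : semi_inner S B.

Lemma semi_inner_suml (I : Type) (s : seq I) (c : I -> R) (w : I -> X -> R) :
  (forall i, S (w i)) ->
  S (fun x => \sum_(i <- s) c i * w i x) /\
  forall y, S y -> B (fun x => \sum_(i <- s) c i * w i x) y
                   = \sum_(i <- s) c i * B (w i) y.
Proof.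
case: SB => S0 SD BD _ _ wS; elim: s => [|i s [IHS IHB]].
  have -> : (fun x => \sum_(i <- [::]) c i * w i x) = (fun=> 0).
    by apply/funext => x; rewrite big_nil.
  (* Linearity at the zero function gives [B 0 y = B 0 y + B 0 y], hence [B 0 y = 0]. *)
  split=> // y Sy; rewrite big_nil; have := BD 1 _ _ _ S0 S0 Sy.
  rewrite (_ : (fun=> _) = (fun=> 0)); first lra.
  by apply/funext => x; rewrite mulr0 add0r.
have -> : (fun x => \sum_(k <- i :: s) c k * w k x) =
          (fun x => c i * w i x + \sum_(k <- s) c k * w k x).
  by apply/funext => x; rewrite big_cons.
split=> [|y Sy]; first exact: SD.
by rewrite BD// IHB// big_cons.
Qed.

Lemma semi_inner_gram (w : nat -> X -> R) :
  (forall i, S (w i)) -> gram_psd (fun i k => B (w i) (w k)).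
Proof.
move=> wS; have [_ _ _ BC B0] := SB; split=> [i k|s]; first exact: BC.
have [Ss Bs] := semi_inner_suml s (fun a => a.1) (fun a => wS a.2).
have := B0 _ Ss; rewrite Bs//; congr (_ <= _); apply: eq_bigr => a _.
rewrite BC// Bs// mulr_sumr; apply: eq_bigr => b _.
by rewrite mulrA BC.
Qed.

Lemma semi_inner_young (p r : X -> R) (c : R) :
  S p -> S r -> 0 <= B p p + 2 * c * B p r + c ^+ 2 * B r r.
Proof.
move=> Sp Sr; pose w (i : nat) := if i is 0%N then p else r.
have := @gram_young R (fun i k => B (w i) (w k)) c 0 1.
by apply; apply: semi_inner_gram => -[].
Qed.

End SemiInner.

Lemma gram_psd_sum (R : realType) (I : finType) (g : I -> nat -> nat -> R) :
  (forall i, gram_psd (g i)) -> gram_psd (fun n m => \sum_i g i n m).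
Proof.
move=> gP; split=> [n m|s].
  by apply: eq_bigr => i _; have [] := gP i.
under eq_bigr do under eq_bigr do rewrite mulr_sumr.
under eq_bigr do rewrite exchange_big.
rewrite exchange_big /=; apply: sumr_ge0 => i _; have [_] := gP i; exact.
Qed.

Lemma gram_psdD (R : realType) (g g' : nat -> nat -> R) :
  gram_psd g -> gram_psd g' -> gram_psd (fun n m => g n m + g' n m).
Proof.
move=> gP gP'.
have := @gram_psd_sum R bool (fun b => if b then g else g') (fun b => if b as b
  return gram_psd (if b then g else g') then gP else gP').
suff -> : (fun n m => \sum_(b : bool) (if b then g else g') n m) =
  (fun n m => g n m + g' n m) by [].
by apply/funext => n; apply/funext => m; rewrite big_bool.
Qed.

Lemma gram_psdZ (R : realType) (c : R) (g : nat -> nat -> R) :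
  0 <= c -> gram_psd g -> gram_psd (fun n m => c * g n m).
Proof.
move=> c0 [gC gP]; split=> [n m|s]; first by rewrite gC.
have -> : \sum_(a <- s) \sum_(b <- s) a.1 * b.1 * (c * g a.2 b.2) =
          c * \sum_(a <- s) \sum_(b <- s) a.1 * b.1 * g a.2 b.2.
  rewrite mulr_sumr; apply: eq_bigr => a _; rewrite mulr_sumr.
  by apply: eq_bigr => b _; rewrite mulrCA.
by rewrite mulr_ge0.
Qed.

(** * Lebesgue measure and square integrable functions *)

(** The sigma-algebra is generated by the coordinates. An open set is the union of the cubes with
    rational centre and radius [1/(m+1)] that it contains, a countable family. *)
Lemma open_measurable_rV (R : realType) (n : nat) (U : set 'rV[R]_n) :
  open U -> measurable U.
Proof.
move=> oU.
pose cube (z : 'rV[rat]_n * nat) : set 'rV[R]_n :=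
  [set x | forall i, `|x 0 i - ratr (z.1 0 i)| < z.2.+1%:R^-1].
have mcube z : measurable (cube z).
  rewrite (_ : cube z = \big[setI/setT]_(i < n)
      ((fun x : 'rV[R]_n => x 0 i) @^-1`
       `]ratr (z.1 0 i) - z.2.+1%:R^-1, ratr (z.1 0 i) + z.2.+1%:R^-1[)).
    apply: bigsetI_measurable => i _; rewrite -[X in measurable X]setTI.
    by apply: measurable_coord => //; exact: measurable_itv.
  rewrite -bigcap_seq; apply/seteqP; split=> x /=.
    by move=> xz i _ /=; rewrite in_itv /= -ltr_distl.
  by move=> xz i; have := xz i (mem_index_enum i); rewrite /= in_itv /= -ltr_distl.
have -> : U = \bigcup_z (if `[< cube z `<=` U >] then cube z else set0).
  apply/seteqP; split=> [x Ux|x [z _]]; last by case: asboolP => // + zx; exact.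
  have /nbhs_ballP[e /= e0 eU] : nbhs x U by exact: open_nbhs_nbhs.
  (* With radius below [e / 2], a cube whose centre is within that radius of [x] stays in the ball
     of radius [e]. *)
  have [m _ /(_ m (leqnn m)) me] : \forall m \near \oo, m.+1%:R^-1 < e / 2 :> R.
    exact: (near_infty_natSinv_lt (PosNum (divr_gt0 e0 (ltr0n _ 2)))).
  pose r : R := m.+1%:R^-1.
  have r0 : 0 < r by rewrite invr_gt0.
  have ex i : exists y : rat, `|x 0 i - ratr y| < r.
    have /rat_in_itvoo[y] : x 0 i - r < x 0 i + r by rewrite ltrD2l gtrN.
    by rewrite in_itv /= -ltr_distlC => ?; exists y.
  pose c : 'rV[rat]_n := \row_i projT1 (cid (ex i)).
  have cE i : `|x 0 i - ratr (c 0 i)| < r by rewrite mxE; case: cid.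
  exists (c, m) => //; rewrite asboolT//= => y cy; apply: eU.
  split=> // i i'; rewrite !ord1 /ball /=.
  rewrite (le_lt_trans (ler_distD (ratr (c 0 i')) _ _))//.
  rewrite [e]splitr ltrD// (lt_trans _ me)//.
  by rewrite distrC; exact: cy.
apply: countable_bigcupT_measurable => [|z]; first exact: countableP.
by case: ifP.
Qed.

Lemma measurable_cube (R : realType) (n : nat) (M : R) :
measurable [set x : 'rV[R]_n | forall i, `|x 0 i| <= M].
Proof.
rewrite (_ : mkset _ = \big[setI/setT]_(i < n)
    ((fun x : 'rV[R]_n => x 0 i) @^-1` `[- M, M])).
  apply: bigsetI_measurable => i _; rewrite -[X in measurable X]setTI.
  by apply: measurable_coord => //; exact: measurable_itv.
rewrite -bigcap_seq; apply/seteqP; split=> x /=.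
  by move=> xz i _ /=; rewrite in_itv /= -ler_norml.
by move=> xz i; have := xz i (mem_index_enum i); rewrite /= in_itv /= -ler_norml.
Qed.

(** Induction along the recursion defining the measure: a cube pulls back under [rV_cons] to an
    interval times a lower-dimensional cube, and dimension [0] carries a Dirac mass. *)
Lemma lebesgue_rV_cube_lty (R : realType) (n : nat) (M : R) :
  (lebesgue_rV R n [set x : 'rV[R]_n | (forall i, `|x 0 i| <= M)%R] < +oo)%E.
Proof.
elim: n => [|n IH]; first by rewrite /= diracE; case: (_ \in _); rewrite ltry.
rewrite /= /lebesgue_cons.
rewrite (_ : _ @^-1` _ = `[- M, M] `*` [set x : 'rV[R]_n | forall i, `|x 0 i| <= M]).
  rewrite product_measure1E.
- rewrite lte_mul_pinfty// ?ge0_fin_numE//.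
  rewrite [X in (X < _)%E](lebesgue_measure_itv `[- M, M]) /=.
  by case: ifP; rewrite ?ltry.
- exact: measurable_itv.
- exact: measurable_cube.
apply/seteqP; split=> -[a v] /= H.
  split; first by have := H 0; rewrite rV_consEl in_itv /= ler_norml.
  by move=> i; have := H (rshift 1 i); rewrite rV_consEr.
case: H => aM vM i; have [->|[k ->]] : i = 0 \/ exists k : 'I_n, i = rshift 1 k.
- rewrite -[i](@splitK 1 n); case: (fintype.split (i : 'I_(1 + n))) => k /=.
    by left; apply/val_inj; rewrite /= ord1.
  by right; exists k.
- by rewrite rV_consEl ler_norml; move: aM; rewrite in_itv.
- by rewrite rV_consEr.
Qed.

Lemma bounded_lebesgue_rV_lty (R : realType) (n : nat) (A : set 'rV[R]_n) :
  measurable A -> bounded_set A -> (lebesgue_rV R n A < +oo)%E.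
Proof.
move=> mA [M [Mr AM]].
(* [bounded_set] provides a bound only for radii strictly above [M]. *)
have {AM} := AM (M + 1); rewrite ltrDl ltr01 => /(_ isT) AM.
apply: le_lt_trans (lebesgue_rV_cube_lty n (M + 1)).
apply: le_measure; rewrite ?inE//; first exact: measurable_cube.
move=> x Ax i; apply: le_trans (AM _ Ax).
rewrite [leRHS]/Num.norm /= mx_normrE.
exact: (le_bigmax _ (fun ij : ordinal 1 * ordinal n => `|x ij.1 ij.2|) (0, i)).
Qed.

Section L2Form.
Variables (R : realType) (d : nat) (Omega : set 'rV[R]_d).
Hypothesis mOmega : measurable Omega.

Lemma L2_integrableM (f g : 'rV[R]_d -> R) : L2 Omega f -> L2 Omega g ->
  (lebesgue_rV R d).-integrable Omega (EFin \o (fun x => f x * g x)).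
Proof.
move=> [mf f2] [mg g2].
apply: (le_integrable mOmega _ _ (integrableD mOmega f2 g2)).
  by apply/measurable_EFinP; exact: measurable_funM.
move=> x _; rewrite /= lee_fin [leRHS]ger0_norm ?addr_ge0 ?sqr_ge0// normrM.
have := sqr_ge0 (`|f x| - `|g x|); have := normr_ge0 (f x); have := normr_ge0 (g x).
rewrite -(real_normK (num_real (f x))) -(real_normK (num_real (g x))).
nra.
Qed.

Lemma L2_cst0 : L2 Omega (fun=> 0).
Proof.
split; first exact: measurable_cst.
rewrite (_ : (fun _ => _) = cst 0%E); first exact: integrable0.
by apply/funext => x; rewrite expr0n.
Qed.

Lemma L2_linear (c : R) (f g : 'rV[R]_d -> R) :
  L2 Omega f -> L2 Omega g -> L2 Omega (fun x => c * f x + g x).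
Proof.
move=> Lf Lg; have [mf f2] := Lf; have [mg g2] := Lg; split.
  by apply: measurable_funD => //; apply: measurable_funM => //; exact: measurable_cst.
apply: (eq_integrable mOmega) (integrableD mOmega
  (integrableD mOmega (integrableZl mOmega (c ^+ 2) f2) g2)
  (integrableZl mOmega (2 * c) (L2_integrableM Lf Lg))) => x _.
by rewrite /= -!EFinM -!EFinD; congr EFin; ring.
Qed.

Lemma ip_semi_inner : semi_inner (L2 Omega) (ip Omega).
Proof.
split.
- exact: L2_cst0.
- exact: L2_linear.
- move=> c f g h Lf Lg Lh; rewrite /ip -RintegralZl//; last exact: L2_integrableM.
  rewrite -RintegralD//; last 2 first.
  + apply: (eq_integrable mOmega) (integrableZl mOmega c (L2_integrableM Lf Lh)) => x _.
    by rewrite /= -EFinM.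
  + exact: L2_integrableM.
  by apply: eq_Rintegral => x _; ring.
- by move=> f g _ _; apply: eq_Rintegral => x _; rewrite mulrC.
- by move=> f _; apply: Rintegral_ge0 => x _; rewrite -expr2 sqr_ge0.
Qed.

Hypothesis finOmega : (lebesgue_rV R d Omega < +oo)%E.

(** Finite measure makes [1 + f^2] an integrable majorant of [|f|]. This lets the zero-mean
    condition in [Qh] pass to linear combinations. *)
Lemma L2_integrable (f : 'rV[R]_d -> R) :
  L2 Omega f -> (lebesgue_rV R d).-integrable Omega (EFin \o f).
Proof.
move=> [mf f2].
have i1 : (lebesgue_rV R d).-integrable Omega (cst 1%E).
  apply/integrableP; split; first exact: measurable_cst.
  by rewrite (eq_integral (cst 1%E)) ?integral_cst ?mul1e// => x _; rewrite /= normr1.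
apply: (le_integrable mOmega _ _ (integrableD mOmega i1 f2)).
  exact/measurable_EFinP.
move=> x _; rewrite /= lee_fin [leRHS]ger0_norm ?addr_ge0 ?sqr_ge0//.
by have := sqr_ge0 (`|f x| - 1); rewrite -(real_normK (num_real (f x))); nra.
Qed.

Lemma Qh_cst0 (T : seq 'M[R]_(d.+1, d)) (l : nat) (cont : bool) :
  Qh Omega T l cont (fun=> 0).
Proof.
split; last by move=> _; exact: cst_continuous.
- split; first exact: L2_cst0.
  move=> K KT; exists (fun=> 0) => x _.
  by rewrite big1// => a _; rewrite mul0r.
- by split; [exact: L2_cst0|rewrite /Rintegral integral0].
Qed.

Lemma Qh_linear (T : seq 'M[R]_(d.+1, d)) (l : nat) (cont : bool) (c : R)
    (p r : 'rV[R]_d -> R) :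
  Qh Omega T l cont p -> Qh Omega T l cont r ->
  Qh Omega T l cont (fun x => c * p x + r x).
Proof.
move=> [[Lp pp] [_ p0] pc] [[Lr rp] [_ r0] rc]; split.
- split; first exact: L2_linear.
  move=> K KT; have [cp pE] := pp K KT; have [cr rE] := rp K KT.
  exists (fun a => c * cp a + cr a) => x Kx; rewrite pE// rE// mulr_sumr -big_split /=.
  by apply: eq_bigr => a _; rewrite mulrDl mulrA.
- split; first exact: L2_linear.
  rewrite RintegralD//; last exact: L2_integrable.
    by rewrite RintegralZl// ?p0 ?r0 ?mulr0 ?addr0//; exact: L2_integrable.
  apply: (eq_integrable mOmega) (integrableZl mOmega c (L2_integrable Lp)) => x _.
  by rewrite /= -EFinM.
- move=> hc x; apply: cvgD; last exact: rc.
  by apply: cvgM; [exact: cvg_cst|exact: pc].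
Qed.

End L2Form.

(** * Gram matrices of the velocity forms *)

Section VelocityForms.
Variables (R : realType) (d : nat) (Omega : set 'rV[R]_d).
Hypothesis mOmega : measurable Omega.

Lemma H10_L2 (f : 'rV[R]_d -> R) : H10 Omega f -> L2 Omega f.
Proof. by move=> [[]]. Qed.

Lemma H10_wderiv_L2 (f : 'rV[R]_d -> R) (i : 'I_d) :
  H10 Omega f -> L2 Omega (wderiv Omega [:: i] f).
Proof.
move=> [[_ /(_ [:: i] isT) [g fg]] _].
(* [wderiv] falls back to zero when no weak derivative exists; membership in [H10] rules this
   out. *)
by have [] := @xgetPex _ (fun=> 0) _ (ex_intro _ g fg).
Qed.

Lemma ip_sqr_ge0 (f : 'rV[R]_d -> R) : 0 <= ip Omega f f.
Proof. by apply: Rintegral_ge0 => x _; rewrite -expr2 sqr_ge0. Qed.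

Lemma normH_sqr (v : 'I_d -> 'rV[R]_d -> R) : normH Omega v ^+ 2 = ipH Omega v v.
Proof. by rewrite sqr_sqrtr// sumr_ge0// => i _; exact: ip_sqr_ge0. Qed.

Lemma ipH_gram (v : nat -> 'I_d -> 'rV[R]_d -> R) :
  (forall n c, L2 Omega (v n c)) ->
  gram_psd (fun n m => ipH Omega (v n) (v m)).
Proof.
move=> vL2; apply: gram_psd_sum => c.
exact: (semi_inner_gram (ip_semi_inner mOmega) (w := fun n => v n c)).
Qed.

Lemma ipH_young (v w : 'I_d -> 'rV[R]_d -> R) (s : R) :
  (forall c, L2 Omega (v c)) -> (forall c, L2 Omega (w c)) ->
  0 <= ipH Omega v v + 2 * s * ipH Omega v w + s ^+ 2 * ipH Omega w w.
Proof.
move=> vL2 wL2; rewrite !mulr_sumr -!big_split /=; apply: sumr_ge0 => c _.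
exact: (semi_inner_young (ip_semi_inner mOmega)).
Qed.

Lemma forma_gram (nu : R) (u : nat -> 'I_d -> 'rV[R]_d -> R) :
  0 <= nu -> (forall n, spaceV Omega (u n)) ->
  gram_psd (fun n m => forma Omega nu (u n) (u m)).
Proof.
move=> nu0 uV; have wL2 n i k : L2 Omega (wderiv Omega [:: k] (u n i)).
  exact: H10_wderiv_L2 (uV n i).
apply: gram_psd_sum => i; apply: gram_psd_sum => k.
have := gram_psdZ nu0 (semi_inner_gram (ip_semi_inner mOmega) (fun n => wL2 n i k)).
congr gram_psd; apply/funext => n; apply/funext => m.
(* A one-term linear combination moves the viscosity out of the integral. *)
have [_ /(_ _ (wL2 m i k))] := semi_inner_suml (ip_semi_inner mOmega)
  [:: tt] (fun=> nu) (fun _ : unit => wL2 n i k).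
rewrite big_seq1 => <-; congr ip.
by apply/funext => x; rewrite big_seq1.
Qed.

Lemma bdf_L2 (q : nat) (tau : R) (u : nat -> 'I_d -> 'rV[R]_d -> R) (n : nat) c :
  (forall k, L2 Omega (u k c)) -> L2 Omega (bdf q tau u n c).
Proof.
move=> uL2.
have [+ _] := semi_inner_suml (ip_semi_inner mOmega) (index_enum 'I_q.+1)
  (fun i => tau^-1 * bdf_coef R q i) (fun i : 'I_q.+1 => uL2 (n - i)%N).
congr L2; apply/funext => x; rewrite /bdf mulr_sumr.
by apply: eq_bigr => i _; rewrite mulrA.
Qed.

(** Multiplication by [tau] clears the [tau^-1] of [bdf], so tests with the [u (n - i)] recombine
    into a test with the discrete derivative. *)
Lemma ipH_bdf (q : nat) (tau : R) (u : nat -> 'I_d -> 'rV[R]_d -> R) (n : nat)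
    (v : 'I_d -> 'rV[R]_d -> R) :
  tau != 0 -> (forall k c, L2 Omega (u k c)) -> (forall c, L2 Omega (v c)) ->
  tau * ipH Omega v (bdf q tau u n) =
  \sum_(i < q.+1) bdf_coef R q i * ipH Omega v (u (n - i)%N).
Proof.
move=> tau0 uL2 vL2; have [_ _ _ ipC _] := ip_semi_inner mOmega.
under [RHS]eq_bigr do rewrite mulr_sumr.
rewrite exchange_big mulr_sumr /=; apply: eq_bigr => c _.
rewrite ipC//; last by apply: bdf_L2.
have [_ /(_ _ (vL2 c))] := semi_inner_suml (ip_semi_inner mOmega) (index_enum 'I_q.+1)
  (fun i => tau^-1 * bdf_coef R q i) (fun i : 'I_q.+1 => uL2 (n - i)%N c).
rewrite (_ : (fun x => _) = bdf q tau u n c); last first.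
  apply/funext => x; rewrite /bdf mulr_sumr.
  by apply: eq_bigr => i _; rewrite mulrA.
move=> ->; rewrite mulr_sumr; apply: eq_bigr => i _.
by rewrite mulrA mulVKf// ipC.
Qed.

End VelocityForms.

(** * The stabilization form and the stability theorem *)

Lemma stabilization_semi_inner (R : realType) (d : nat) (Omega : set 'rV[R]_d)
    (nu : R) (Th : R -> seq 'M[R]_(d.+1, d)) (l : nat) (cont : bool)
    (j : R -> ('rV[R]_d -> R) -> ('rV[R]_d -> R) -> R) (h : R) :
  measurable Omega -> (lebesgue_rV R d Omega < +oo)%E ->
  stabilization Omega nu Th l cont j -> 0 < h <= 1 ->
  semi_inner (Qh Omega (Th h) l cont) (j h).
Proof.
move=> mO fO [hj _] hh; have [jD jC j0] := hj h hh; split=> //.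
- exact: Qh_cst0.
- by move=> c p r; exact: Qh_linear.
Qed.

Theorem theorem4p2 (R : realType) (d : nat) (hd : d = 2%N \/ d = 3%N)
    (Omega : set 'rV[R]_d) (hOmega : lipschitz_domain Omega)
    (nu : R) (hnu : 0 < nu)
    (Th : R -> seq 'M[R]_(d.+1, d)) (hTh : quasi_uniform Omega Th)
    (k l : nat) (hk : (1 <= k)%N) (hkl : (k.-1 <= l <= k)%N) (cont : bool)
    (j : R -> ('rV[R]_d -> R) -> ('rV[R]_d -> R) -> R)
    (hj : stabilization Omega nu Th l cont j)
    (lbar : nat) (hlbar : (1 <= lbar)%N)
    (hI : quasi_interpolation Omega nu Th k l lbar cont j)
    (q : nat) (hq : (1 <= q <= 5)%N) :
  exists2 C : R, 0 < C &
  forall (h : R) (hh : 0 < h <= 1)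
    (T : R) (hT : 0 < T) (Nt : nat) (hNt : (0 < Nt)%N),
  let tau := T / Nt%:R in
  forall (f : R -> 'I_d -> 'rV[R]_d -> R) (hf : continuous_L2 Omega T f)
    (u : nat -> 'I_d -> 'rV[R]_d -> R) (p : nat -> 'rV[R]_d -> R)
    (huV : forall n, (n < q)%N || (n <= Nt)%N -> Vh Omega (Th h) k (u n))
    (hpQ : forall n, (n < q)%N || (n <= Nt)%N -> Qh Omega (Th h) l cont (p n))
    (hinit : forall i, (i < q)%N ->
       forall qh, Qh Omega (Th h) l cont qh ->
         formb Omega qh (u i) - j h (p i) qh = 0)
    (hmom : forall n, (q <= n <= Nt)%N ->
       forall vh, Vh Omega (Th h) k vh ->
         ipH Omega (bdf q tau u n) vh + forma Omega nu (u n) vh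
           + formb Omega (p n) vh
         = ipH Omega (f (n%:R * tau)) vh)
    (hdiv : forall n, (q <= n <= Nt)%N ->
       forall qh, Qh Omega (Th h) l cont qh ->
         formb Omega qh (u n) - j h qh (p n) = 0)
    (N : nat) (hN : 0 <= N%:R * tau <= T),
  l2norm q N tau (fun n => normH Omega (bdf q tau u n)) ^+ 2
    + normV Omega nu (u N) ^+ 2 + seminorm_j (j h) (p N) ^+ 2
  <= C * (\sum_(i < q) (normV Omega nu (u i) ^+ 2
                        + seminorm_j (j h) (p i) ^+ 2)
          + l2norm q N tau (fun n => normH Omega (f (n%:R * tau))) ^+ 2).
Proof.
have [oO _ _ bO _] := hOmega.
have mO : measurable Omega by exact: open_measurable_rV.
have fO := bounded_lebesgue_rV_lty mO bO.
have [C C0 estimate] := bdf_estimate R hq.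
(* [C] serves [N >= q]; the added [1] serves [N < q], where the left side is one of the initial
   terms. *)
exists (C + 1) => [|h hh T hT Nt hNt tau f hf u p huV hpQ hinit hmom hdiv N hN].
  by rewrite addr_gt0.
have tau0 : 0 < tau by rewrite divr_gt0// ltr0n.
have NNt : (N <= Nt)%N.
  move: hN => /andP[_]; rewrite /tau mulrCA ger_pMr// ler_pdivrMr ?ltr0n//.
  by rewrite mul1r ler_nat.
have jS := stabilization_semi_inner mO fO hj hh; have [_ _ _ jC j0] := jS.
have uS n : (n < q)%N || (n <= Nt)%N -> spaceV Omega (u n) by move=> /huV[].
pose A n m := forma Omega nu (u n) (u m) + j h (p n) (p m).
have normA n : (n < q)%N || (n <= Nt)%N ->
    normV Omega nu (u n) ^+ 2 + seminorm_j (j h) (p n) ^+ 2 = A n n.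
  move=> nq; rewrite !sqr_sqrtr//; first exact/j0/hpQ.
  (* Nonnegativity of [forma] is read off the Gram matrix of a constant sequence. *)
  exact: (gram_diag_ge0 0 (forma_gram mO (ltW hnu) (fun=> uS n nq))).
have A0 n : (n < q)%N || (n <= Nt)%N -> 0 <= A n n.
  by move=> nq; rewrite -normA// addr_ge0// sqr_ge0.
rewrite -[leLHS]addrA.
rewrite [X in _ + X <= _](normA N); last by rewrite NNt orbT.
rewrite [X in _ <= _ * (X + _)](eq_bigr (fun i : 'I_q => A i i)); last first.
  by move=> i _; rewrite normA// ltn_ord.
have Sinit : 0 <= \sum_(i < q) A i i by apply: sumr_ge0 => i _; rewrite A0// ltn_ord.
have l2E (w : nat -> 'I_d -> 'rV[R]_d -> R) :
    l2norm q N tau (fun n => normH Omega (w n)) ^+ 2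
    = tau * \sum_(q <= n < N.+1) ipH Omega (w n) (w n).
  rewrite sqr_sqrtr; first by congr (_ * _); apply: eq_bigr => n _; rewrite normH_sqr.
  by apply: mulr_ge0; [exact: ltW|apply: sumr_ge0 => n _; exact: sqr_ge0].
rewrite !l2E.
have SF : 0 <= tau * \sum_(q <= n < N.+1)
                       ipH Omega (f (n%:R * tau)) (f (n%:R * tau)).
  by rewrite -l2E sqr_ge0.
have [Nq|qN] := ltnP N q.
  rewrite big_geq// mulr0 add0r.
  have : A N N <= \sum_(i < q) A i i.
    by rewrite (bigD1 (Ordinal Nq))//= lerDl sumr_ge0// => i _; rewrite A0// ltn_ord.
  have : 0 <= C * (\sum_(i < q) A i i + tau * \sum_(q <= n < N.+1)
                     ipH Omega (f (n%:R * tau)) (f (n%:R * tau))).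
    by rewrite mulr_ge0 ?addr_ge0// ltW.
  by rewrite mulrDl mul1r; lra.
(* Freezing the sequences after [N] makes the Gram matrices infinite. *)
pose x n := minn n N.
have xN n : (x n <= N)%N by exact: geq_minr.
have xE n : (n <= N)%N -> x n = n by move=> /minn_idPl.
have xq n : (x n < q)%N || (x n <= Nt)%N by rewrite (leq_trans (xN n)) ?orbT.
pose u' n := u (x n); pose p' n := p (x n).
pose d' n := bdf q tau u' n; pose f' n := f ((x n)%:R * tau).
have dE n : (n <= N)%N -> d' n = bdf q tau u n.
  move=> nN; apply/funext => c; apply/funext => y; congr (_ * _).
  by apply: eq_bigr => i _; rewrite /u' xE// (leq_trans (leq_subr _ _)).
have u'L2 n c : L2 Omega (u' n c) by apply: H10_L2; exact: uS.
have d'L2 n c : L2 Omega (d' n c) by exact: bdf_L2.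
have f'L2 n c : L2 Omega (f' n c).
  case: hf => + _; apply; apply/andP; split; first by rewrite mulr_ge0// ltW.
  by case/andP: hN => _; apply: le_trans; rewrite ler_pM2r// ler_nat.
have AP : gram_psd (fun n m => A (x n) (x m)).
  apply: gram_psdD; first by apply: (forma_gram mO (ltW hnu)) => n; exact: uS.
  by apply: (semi_inner_gram jS) => n; exact: hpQ.
have momentum n m : (q <= n <= N)%N -> (m <= N)%N ->
    ipH Omega (d' n) (u' m) + A (x n) (x m) = ipH Omega (f' n) (u' m).
  move=> /andP[qn nN] mN; rewrite dE// /u' /f' !xE//.
  have nNt : (q <= n <= Nt)%N by rewrite qn (leq_trans nN).
  have mNt : (m < q)%N || (m <= Nt)%N by rewrite (leq_trans mN) ?orbT.
  have pn : Qh Omega (Th h) l cont (p n) by apply: hpQ; rewrite (leq_trans nN) ?orbT.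
  rewrite -(hmom n nNt _ (huV m mNt)) -addrA; congr (_ + (_ + _)).
  (* The constraint for the initial values has the arguments of [j h] in the opposite order, so only
     that case calls for symmetry. *)
  have [mq|qm] := ltnP m q.
    by rewrite jC//; [apply/esym/subr0_eq; exact: hinit|exact: hpQ].
  by apply/esym/subr0_eq; apply: hdiv => //; rewrite qm (leq_trans mN).
have := estimate (fun n m => A (x n) (x m)) (fun n m => ipH Omega (d' n) (d' m))
  (fun n m => ipH Omega (f' n) (d' m)) (fun n => ipH Omega (f' n) (f' n)) tau N
  qN tau0 AP (ipH_gram mO d'L2).
have young n m s : 0 <= ipH Omega (f' n) (f' n) + 2 * s * ipH Omega (f' n) (d' m)
                        + s ^+ 2 * ipH Omega (d' m) (d' m).
  exact: ipH_young.
have tested n m : (q <= n <= N)%N -> (q <= m <= N)%N ->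
    tau * ipH Omega (d' n) (d' m)
      + \sum_(i < q.+1) bdf_coef R q i * A (x n) (x (m - i)%N)
    = tau * ipH Omega (f' n) (d' m).
  (* The momentum equation at [n], tested with [u' (m - i)], is summed with the BDF weights. *)
  move=> nN /andP[_ mN]; rewrite !ipH_bdf ?gt_eqF// -big_split /=.
  apply: eq_bigr => i _; rewrite -mulrDr momentum//.
  by rewrite (leq_trans (leq_subr _ _)).
move=> /(_ young tested); rewrite xE//.
have -> : \sum_(i < q) A (x i) (x i) = \sum_(i < q) A i i.
  by apply: eq_bigr => i _; rewrite xE// (leq_trans (ltnW (ltn_ord i))).
have -> : \sum_(q <= n < N.+1) ipH Omega (d' n) (d' n)
        = \sum_(q <= n < N.+1) ipH Omega (bdf q tau u n) (bdf q tau u n).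
  by apply: eq_big_nat => n /andP[_ nN]; rewrite dE.
have -> : \sum_(q <= n < N.+1) ipH Omega (f' n) (f' n)
        = \sum_(q <= n < N.+1) ipH Omega (f (n%:R * tau)) (f (n%:R * tau)).
  by apply: eq_big_nat => n /andP[_ nN]; rewrite /f' xE.
move/le_trans; apply; rewrite mulrDl mul1r lerDl addr_ge0//.
Qed.
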